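(* Let $m \ge n \ge 2$ and let $L : M_{m,n} \to M_{m,n}$ be an invertible linear map such that $L(S(\mathbb{R}^n_+,\mathbb{R}^m_+)) \subset S(\mathbb{R}^n_+,\mathbb{R}^m_+)$. Then the following two conditions are equivalent: (i) there exist an invertible row positive matrix $X \in M_m$ and an inverse nonnegative matrix $Y \in M_n$ such that $L(A) = XAY$ for all $A \in M_{m,n}$; (ii) for every $i\in\{1,\dots,n\}$, every $\mathbf{x}\in\mathbb{R}^m$ and every $y_i\in\mathbb{R}$, if the matrix $A_i = \mathbf{x}\mathbf{y}_i^t$ with $\mathbf{y}_i = (0,\dots,0,y_i,0,\dots,0)^t \in \mathbb{R}^n$ ($y_i$ in the $i$-th position) is semipositive, then $L(A_i)$ has rank one.
   Context: $M_{m,n}$ is the space of real $m\times n$ matrices and $M_n = M_{n,n}$. $\mathbb{R}^n_+$ is the nonnegative orthant in $\mathbb{R}^n$. A matrix $A\in M_{m,n}$ is semipositive if there is $x \in \mathbb{R}^n$ with $x>0$ and $Ax>0$ (componentwise strict inequalities); $S(\mathbb{R}^n_+,\mathbb{R}^m_+)$ denotes the set of all semipositive $m\times n$ matrices. A matrix is row positive if it is entrywise nonnegative and every row contains at least one nonzero entry. A square matrix $Y$ is inverse nonnegative if it is invertible and $Y^{-1}$ is entrywise nonnegative. *)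

(* Defs.v *)
From HB Require Import structures.
From mathcomp Require Import all_boot all_order all_algebra.
From mathcomp Require Import reals.

Set Implicit Arguments.
Unset Strict Implicit.
Unset Printing Implicit Defensive.

Import Order.TTheory GRing.Theory Num.Theory.
Local Open Scope ring_scope.

Definition positive_mx (R : realType) (m n : nat) (A : 'M[R]_(m, n)) : Prop :=
  forall i j, 0 < A i j.

Definition nonneg_mx (R : realType) (m n : nat) (A : 'M[R]_(m, n)) : Prop :=
  forall i j, 0 <= A i j.

Definition semipositive (R : realType) (m n : nat) (A : 'M[R]_(m, n)) : Prop :=
  exists x : 'cV[R]_n, positive_mx x /\ positive_mx (A *m x).

Definition row_positive (R : realType) (m n : nat) (A : 'M[R]_(m, n)) : Prop :=
  nonneg_mx A /\ forall i, exists j, A i j != 0.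

Definition inverse_nonneg (R : realType) (n : nat) (Y : 'M[R]_n) : Prop :=
  Y \in unitmx /\ nonneg_mx (invmx Y).

(* Main.v *)
Require Import Defs.
From HB Require Import structures.
From mathcomp Require Import all_boot all_order all_algebra.
From mathcomp Require Import boolp reals.
From mathcomp Require Import ring lra.

Set Implicit Arguments.
Unset Strict Implicit.
Unset Printing Implicit Defensive.

Import Order.TTheory GRing.Theory Num.Theory.
Local Open Scope ring_scope.

(** Write [e_l] for the [l]-th unit row vector, so that [A] is the sum of the
    rank one matrices [col l A *m e_l].

    The implication from (i) to (ii) only says that invertible factors preserve
    the rank.  For the converse, [x *m e_l] is semipositive for every positive
    column [x], so (ii) says that [L] has rank one on an open cone of columns
    [x].  The 2 x 2 minors are quadratic forms in [x]; vanishing on an open cone,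
    they vanish identically ([minor_eq0_of_positive]).  A linear space of matrices
    of rank at most one consists of multiples of a common row, or of multiples
    of a common column ([rank_le1_space]), which gives for each [l] one of
      [L (x *m e_l) = X l *m x *m v l]   or   [L (x *m e_l) = u *m (G *m x)^T].

    Everything else comes from a single obstruction ([semipositive_comb_gt0]): if
    [B] is semipositive, no nonnegative nonzero combination [lam *m B] of its
    rows is nonpositive.  Each unwanted configuration is refuted by a semipositive
    [A] for which some such combination of the rows of [L A] is nonpositive.
    - In the common column case, [G] is onto because [n <= m], so a suitable
      [x *m e_j], added to [1 *m e_i] with [i != j], makes a whole row of the image
      equal to -1 ([no_common_column]).
    - If [lam *m X i] and [lam *m X j] have different kernels, the columns of [A]
      can be tuned so that [A *m 1 = 1] while [lam *m L A] has all entries -1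
      ([dual_kernel_sub]).  Hence every nonnegative row vector is a left
      eigenvector of [X j *m invmx (X i)], which is therefore a scalar matrix
      ([scalar_of_dual_kernel]).  All the [X l] are thus multiples of one [X],
      and [L A = X *m A *m Y].
    - A negative entry of [X], or of [invmx Y], produces such an [A] of rank one
      ([factor_signs]); before that, [(X, Y)] is replaced by [(- X, - Y)] if
      necessary, to make [X *m 1] positive. *)

(** * Spaces of matrices of rank at most one *)

Lemma rank_le1_minor (F : fieldType) (m n : nat) (A : 'M[F]_(m, n)) :
  (\rank A <= 1)%N -> forall a b c d, A a b * A c d = A a d * A c b.
Proof.
move=> rA a b c d.
have [r [C [D [-> r1]]]] : exists r (C : 'M[F]_(m, r)) (D : 'M[F]_(r, n)),
    A = C *m D /\ (r <= 1)%N.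
  by exists (\rank A), (col_base A), (row_base A); rewrite mulmx_base.
rewrite !mxE; case: r C D r1 => [|[|//]] C D _.
  by rewrite !big_ord0 !mul0r.
by rewrite !big_ord1; ring.
Qed.

(** The constant [s] is one more than the 1-norm of [x], an explicit size at which
    a constant column lies deep enough in the open positive cone for both
    perturbations by [x] and by [- x] to stay inside. *)
Lemma const_mx_dominates (R : realType) (p : nat) (x : 'cV[R]_p) :
  exists s, [/\ 0 < s, positive_mx (const_mx s + x)
    & positive_mx (const_mx s - x)].
Proof.
pose s : R := 1 + \sum_j `|x j 0|.
have xs j : `|x j 0| < s.
  by rewrite /s (bigD1 j) //= addrCA ltrDl ltr_wpDr // sumr_ge0.
exists s; split=> [|j l|j l].
- by rewrite ltr_wpDr // sumr_ge0.
- rewrite !mxE (ord1 l); have := xs j; rewrite ltr_norml => /andP [+ _].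
  by rewrite -subr_gt0 opprK addrC.
- by rewrite !mxE (ord1 l) subr_gt0; have := xs j; rewrite ltr_norml => /andP [].
Qed.

(** A 2 x 2 minor of [T x] is a quadratic form [q] of [x] that vanishes on the
    positive cone.  With [P], [P + x] and [P - x] all positive, the parallelogram
    identity [q (P + x) + q (P - x) = 2 q P + 2 q x] gives [q x = 0]. *)
Lemma minor_eq0_of_positive (R : realType) (p m n : nat)
    (T : {linear 'cV[R]_p -> 'M[R]_(m, n)}) :
  (forall x, positive_mx x -> (\rank (T x) <= 1)%N) ->
  forall x a b c d, T x a b * T x c d = T x a d * T x c b.
Proof.
move=> rT x a b c d.
have minor y : positive_mx y -> T y a b * T y c d = T y a d * T y c b.
  by move=> /rT /rank_le1_minor.
have [s [s_gt0 hPD hPB]] := const_mx_dominates x.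
have hP : positive_mx (const_mx s : 'cV_p) by move=> j l; rewrite mxE.
move: (const_mx s) hP hPD hPB => P hP hPD hPB.
have := minor _ hP; have := minor _ hPD; have := minor _ hPB.
rewrite (linearB T) (linearD T P x) !mxE.
move: (T x a b) (T x c d) (T x a d) (T x c b) (T P a b) (T P c d).
move: (T P a d) (T P c b) => * {s s_gt0 P hP hPD hPB minor}.
lra.
Qed.

(** Around a nonzero pivot entry [(a, b)] of [M = T x0], polarising the minors of
    [x0] and [x] shows that row [a] of [T x] is a multiple of row [a] of [M], or
    column [b] of [T x] is a multiple of column [b] of [M].  Both conditions are
    linear in [x], and a vector space is not the union of two proper subspaces,
    so one of them holds for all [x]; it then propagates to the whole matrix.
    The factors are given as a column or a row of [T x] itself, hence depend
    linearly on [x]. *)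
Lemma rank_le1_space (F : fieldType) (V : lmodType F) (m n : nat)
    (T : {linear V -> 'M[F]_(m, n)}) (x0 : V) :
  (forall x a b c d, T x a b * T x c d = T x a d * T x c b) -> T x0 != 0 ->
  (exists b (v : 'rV_n), forall x, T x = col b (T x) *m v) \/
  (exists a (u : 'cV_m), forall x, T x = u *m row a (T x)).
Proof.
move=> minor /matrix0Pn [a [b M0]].
set M := T x0 in M0.
have polar x c d :
    M a b * T x c d + T x a b * M c d = M a d * T x c b + T x a d * M c b.
  have := minor (x0 + x) a b c d; rewrite linearD -/M !mxE => e3.
  have e2 := minor x a b c d; have e1 := minor x0 a b c d; rewrite -/M in e1.
  apply: (addIr (M a d * M c b + T x a d * T x c b)).
  transitivity ((M a d + T x a d) * (M c b + T x c b)); last by ring.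
  by rewrite -e3 -e1 -e2; ring.
pose inRow x := forall d, T x a d * M a b = T x a b * M a d.
pose inCol x := forall c, T x c b * M a b = T x a b * M c b.
have dich x : inRow x \/ inCol x.
  (* Up to a factor, the entries in row a and column b of T x minus the multiple
     of M that cancels its entry (a, b): their product is a minor of it. *)
  have prod c d : (T x a d * M a b - T x a b * M a d)
                * (T x c b * M a b - T x a b * M c b) = 0.
    have e1 := minor x0 a b c d; have e2 := minor x a b c d.
    have e3 := polar x c d; rewrite -/M in e1.
    transitivity (M a b ^+ 2 * (T x a d * T x c b)
      - M a b * T x a b * (M a d * T x c b + T x a d * M c b)
      + T x a b ^+ 2 * (M a d * M c b)); first by ring.
    by rewrite -e1 -e2 -e3; ring.
  have [/forallP r|/forallPn [d nd]] := boolP [forall d, T x a d * M a b == T x a b * M a d].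
    by left=> d; apply/eqP.
  right=> c; apply/eqP; have /eqP := prod c d.
  by rewrite mulf_eq0 !subr_eq0 (negPf nd).
have all_or : (forall x, inRow x) \/ (forall x, inCol x).
  (* If x fails the first condition and y the second, x + y fails both. *)
  have [|/existsNP [x nrx]] := EM (forall x, inRow x); first by left.
  right=> y; have [ry|//] := dich y; have [//|cx] := dich x.
  have [rxy|cxy] := dich (x + y).
    case: nrx => d; have := rxy d; have := ry d.
    by rewrite linearD !mxE !mulrDl => -> /addIr.
  move=> c; have := cxy c; have := cx c.
  by rewrite linearD !mxE !mulrDl => -> /addrI.
case: all_or => h; [left; exists b, ((M a b)^-1 *: row a M)
  | right; exists a, ((M a b)^-1 *: col b M)] => x; apply/matrixP => c d;
  rewrite !mxE big_ord1 !mxE; apply: (mulIf M0);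
  have e1 := polar x c d; have e2 := minor x0 a b c d; rewrite -/M in e2.
- rewrite mulrA (mulrAC (T x c b)) mulfVK//.
  apply: (mulIf M0); have e3 := h x d.
  transitivity (M a b * (M a b * T x c d + T x a b * M c d)
    - T x a b * (M a b * M c d)); first by ring.
  rewrite e1 e2.
  transitivity (M a b * M a d * T x c b + T x a d * M a b * M c b
    - T x a b * (M a d * M c b)); first by ring.
  by rewrite e3; ring.
- rewrite [RHS]mulrC -!mulrA mulVKf//.
  apply: (mulIf M0); have e3 := h x c.
  transitivity (M a b * (M a b * T x c d + T x a b * M c d)
    - T x a b * (M a b * M c d)); first by ring.
  rewrite e1 e2.
  transitivity (M a d * (T x c b * M a b) + T x a d * M a b * M c b
    - T x a b * (M a d * M c b)); first by ring.
  by rewrite e3; ring.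
Qed.

(** * Columns and linear maps between them *)

Lemma mx_sum_col (R : nzRingType) (m n : nat) (A : 'M[R]_(m, n)) :
  A = \sum_l col l A *m delta_mx 0 l.
Proof.
apply/matrixP=> k j; rewrite summxE (bigD1 j) //= big1 ?addr0.
  by rewrite !mxE big_ord1 !mxE !eqxx mulr1.
by move=> l lj; rewrite !mxE big_ord1 !mxE (negPf (_ : j != l)) ?andbF ?mulr0 // eq_sym.
Qed.

Lemma col_mul_delta (R : nzRingType) (m n : nat) (x : 'cV[R]_m) (l : 'I_n) :
  col l (x *m delta_mx 0 l) = x.
Proof.
apply/matrixP=> k j; rewrite !mxE big_ord1 !mxE !eqxx mulr1.
by rewrite (ord1 j).
Qed.

Lemma delta_mul_ones (R : nzRingType) (m n : nat) (x : 'cV[R]_m) (l : 'I_n) :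
  x *m delta_mx 0 l *m (const_mx 1 : 'cV_n) = x.
Proof.
rewrite -mulmxA -rowE row_const.
by apply/matrixP=> k j; rewrite mxE big_ord1 mxE mulr1 (ord1 j).
Qed.

Lemma linear_cV_mx (R : comNzRingType) (p q : nat)
    (f : {linear 'cV[R]_p -> 'cV[R]_q}) :
  exists X : 'M_(q, p), forall x, f x = X *m x.
Proof.
exists (\matrix_(k, j) f (delta_mx j 0) k 0) => x.
have {1}-> : x = \sum_j x j 0 *: delta_mx j 0.
  by rewrite {1}[x]matrix_sum_delta; apply: eq_bigr => j _; rewrite big_ord1.
rewrite linear_sum; apply/matrixP => k l; rewrite summxE mxE (ord1 l).
by apply: eq_bigr => j _; rewrite linearZ !mxE mulrC.
Qed.

(** * Obstructions to semipositivity *)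

Lemma semipositive_ones (R : realType) (m n : nat) (A : 'M[R]_(m, n)) :
  positive_mx (A *m (const_mx 1 : 'cV_n)) -> semipositive A.
Proof. by exists (const_mx 1); split=> // j l; rewrite mxE. Qed.

(** For a positive [z] with [A *m z] positive, [lam *m A *m z] is positive; this
    would fail if [lam *m A] were nonpositive.  This is the easy half of the
    theorem of the alternative for semipositive matrices. *)
Lemma semipositive_comb_gt0 (R : realType) (m n : nat) (A : 'M[R]_(m, n))
    (lam : 'rV[R]_m) :
  semipositive A -> nonneg_mx lam -> lam != 0 ->
  exists l, 0 < (lam *m A) 0 l.
Proof.
move=> [z [z_gt0 Az_gt0]] lam_ge0 /matrix0Pn [i0 [k lamk]].
rewrite (ord1 i0) in lamk.
have pos : 0 < (lam *m A *m z) 0 0.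
  rewrite -mulmxA mxE (bigD1 k) //= ltr_pwDl //.
    by rewrite mulr_gt0 // lt0r lamk lam_ge0.
  by apply: sumr_ge0 => l _; rewrite mulr_ge0 // ltW.
apply/existsP; apply: contraLR pos => /existsPn neg.
rewrite -leNgt mxE; apply: sumr_le0 => l _.
by rewrite mulr_le0_ge0 ?(ltW (z_gt0 _ _)) // leNgt neg.
Qed.

Lemma delta_row_nonneg (R : realType) (m : nat) (k : 'I_m) :
  nonneg_mx (delta_mx 0 k : 'rV[R]_m).
Proof. by move=> i j; rewrite mxE. Qed.

Lemma delta_row_neq0 (R : realType) (m : nat) (k : 'I_m) :
  (delta_mx 0 k : 'rV[R]_m) != 0.
Proof. by apply/matrix0Pn; exists 0, k; rewrite mxE !eqxx oner_neq0. Qed.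

Lemma semipositive_row_gt0 (R : realType) (m n : nat) (A : 'M[R]_(m, n)) k :
  semipositive A -> exists l, 0 < A k l.
Proof.
move=> /semipositive_comb_gt0 /(_ (delta_row_nonneg R k) (delta_row_neq0 R k)).
by move=> [l]; rewrite -rowE mxE; exists l.
Qed.

Lemma row_full_of_kernel0 (F : fieldType) (p q : nat) (A : 'M[F]_(p, q)) :
  (forall x : 'cV_q, A *m x = 0 -> x = 0) -> row_full A.
Proof.
move=> ker0; suff : row_free A^T by rewrite /row_free /row_full mxrank_tr.
apply: inj_row_free => v hv; apply: trmx_inj; rewrite trmx0.
by apply: ker0; apply: trmx_inj; rewrite trmx_mul trmxK trmx0.
Qed.

(** A column killed by [Y] is killed by every value of [f], that is, by every
    matrix. *)
Lemma right_factor_unit (F : fieldType) (m n : nat)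
    (f : 'M[F]_(m, n) -> 'M[F]_(m, n)) (Y : 'M_n) :
  (0 < m)%N -> bijective f -> (forall A, exists C, f A = C *m Y) ->
  Y \in unitmx.
Proof.
move=> m_gt0 [g _ gK] hf; rewrite -row_full_unit.
apply: row_full_of_kernel0 => w Yw; apply/matrixP => j l; rewrite (ord1 l).
have [C] := hf (g (delta_mx (Ordinal m_gt0) j)); rewrite gK.
move=> /(congr1 (mulmx^~ w)) /=; rewrite -mulmxA Yw mulmx0.
move=> /matrixP /(_ (Ordinal m_gt0) 0); rewrite !mxE => <-.
rewrite (bigD1 j) //= big1 ?addr0 => [|k kj]; first by rewrite mxE !eqxx mul1r.
by rewrite mxE (negPf kj) andbF mul0r.
Qed.

(** If the images of all [x *m e_j] had their columns on one line, spanned by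
    [u], their common row part would be an injective linear function [G] of [x],
    hence onto since [n <= m].  Taking [u k 0 != 0] and another index [i],
    one can choose [x] so that row [k] of
    [L (1 *m e_i + x *m e_j)] is -1 everywhere, although the argument is
    semipositive whatever [x] is: weight its column [i] heavily. *)
Lemma no_common_column (R : realType) (m n : nat)
    (L : {linear 'M[R]_(m, n) -> 'M[R]_(m, n)}) (j : 'I_n) :
  (1 < n)%N -> (n <= m)%N -> injective L ->
  (forall A, semipositive A -> semipositive (L A)) ->
  ~ exists a (u : 'cV_m), forall x : 'cV_m,
      L (x *m delta_mx 0 j) = u *m row a (L (x *m delta_mx 0 j)).
Proof.
move=> n_gt1 le_nm injL hS [a [u hu]].
have [G hG] := linear_cV_mx (trmx \o row a \o L \o mulmxr (delta_mx 0 j)).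
rewrite /= in hG.
have G_inj (x : 'cV_m) : G *m x = 0 -> x = 0.
  rewrite -hG => /(congr1 trmx); rewrite trmxK trmx0 => rx.
  have : L (x *m delta_mx 0 j) = L 0 by rewrite hu rx mulmx0 linear0.
  by move=> /injL /(congr1 (col j)); rewrite col_mul_delta col0.
have [B GB] : exists B, G *m B = 1%:M.
  apply/row_freeP; rewrite /row_free eqn_leq rank_leq_row.
  by have /eqP -> := row_full_of_kernel0 G_inj.
have [k uk] : exists k, u k 0 != 0.
  have /matrix0Pn [k [l]] : u != 0.
    apply/eqP => u0.
    have : L ((const_mx 1 : 'cV_m) *m delta_mx 0 j) = L 0 by rewrite hu u0 mul0mx linear0.
    move=> /injL /(congr1 (col j)) /matrixP /(_ a 0); rewrite col_mul_delta !mxE.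
    by apply/eqP; rewrite oner_neq0.
  by rewrite (ord1 l); exists k.
have [i ij] : exists i : 'I_n, i != j.
  apply/existsP; apply: contraLR n_gt1 => /existsPn jP.
  rewrite -leqNgt -[n]card_ord; apply/card_le1_eqP => x y _ _.
  by have := jP x; have := jP y; rewrite !negbK => /eqP -> /eqP ->.
pose M := L ((const_mx 1 : 'cV_m) *m delta_mx 0 i).
have [x Gx] : exists x, G *m x = \col_l ((u k 0)^-1 * (- 1 - M k l)).
  by exists (B *m (\col_l ((u k 0)^-1 * (- 1 - M k l)))); rewrite mulmxA GB mul1mx.
have [s [s_gt0 sx _]] := const_mx_dominates x.
pose A := (const_mx 1 : 'cV_m) *m delta_mx 0 i + x *m delta_mx 0 j.
have : semipositive A.
  exists (const_mx 1 + (s - 1) *: delta_mx i 0); split.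
    move=> l h; rewrite !mxE (ord1 h) andbT.
    by case: eqP => _; rewrite ?mulr1 ?mulr0 ?addr0 // addrC subrK.
  rewrite mulmxDr mulmxDl !delta_mul_ones -scalemxAr mulmxDl -!mulmxA.
  rewrite !mul_delta_mx_cond eqxx eq_sym (negPf ij) mulr0n mulmx0 addr0.
  move=> h l; have := sx h l.
  rewrite !mxE big_ord1 !mxE (ord1 l) !eqxx.
  by rewrite !mulr1 addrAC (addrC 1) subrK.
move=> /hS /(semipositive_row_gt0 k) [l].
rewrite linearD -/M hu mxE [X in _ + X]mxE big_ord1.
have -> : row a (L (x *m delta_mx 0 j)) = (G *m x)^T by rewrite -hG trmxK.
rewrite Gx !mxE mulVKf // addrC subrK.
by rewrite ltr0N1.
Qed.

(** If [lam *m X i *m t = 0] but [lam *m X j *m t != 0], moving a multiple of [t]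
    from column [j] to column [i] of a matrix keeps its row sums, while only
    column [j] contributes to the change of [lam *m L A].  This freedom is enough to
    prescribe both [A *m 1 = 1] and [lam *m L A = -1], which is impossible. *)
Lemma dual_kernel_sub (R : realType) (m n : nat)
    (L : {linear 'M[R]_(m, n) -> 'M[R]_(m, n)})
    (X : 'I_n -> 'M[R]_m) (Y : 'M[R]_n) :
  (forall A, semipositive A -> semipositive (L A)) ->
  (forall l x, L (x *m delta_mx 0 l) = X l *m x *m row l Y) ->
  (forall l, X l \in unitmx) -> Y \in unitmx ->
  forall (lam : 'rV_m) i j (t : 'cV_m), nonneg_mx lam -> lam != 0 ->
  lam *m X i *m t = 0 -> lam *m X j *m t = 0.
Proof.
move=> hS hL hX hY lam i j t lam_ge0 lam_neq0 it.
have /matrix0Pn [i0 [k]] := lam_neq0; rewrite (ord1 i0) => lamk.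
apply/eqP/contraT => jt.
have {}jt : (lam *m X j *m t) 0 0 != 0.
  by case/matrix0Pn: jt => p [q]; rewrite (ord1 p) (ord1 q).
(* The coordinates of the row -1 in the basis of the rows of Y: the goal is to
   let column l of A contribute c_l to lam *m L A. *)
pose c : 'rV_n := const_mx (- 1) *m invmx Y.
have [y hy] : exists y : 'I_n -> 'cV_m, forall l, lam *m X l *m y l = (c 0 l)%:M.
  exists (fun l => invmx (X l) *m ((c 0 l / lam 0 k) *: delta_mx k 0)) => l.
  rewrite mulmxA mulmxK // -scalemxAr -colE [LHS]mx11_scalar !mxE.
  by rewrite divfK.
(* The columns y l alone give lam *m L A = -1; their row sums miss 1 by g, which
   is split between columns i and j without affecting lam *m L A. *)
pose g := const_mx 1 - \sum_l y l.
have [s [w [sw jw]]] : exists s (w : 'cV_m), s *: t + w = g /\ lam *m X j *m w = 0.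
  exists ((lam *m X j *m g) 0 0 / (lam *m X j *m t) 0 0).
  eexists; split; first exact: subrKC.
  rewrite [LHS]mx11_scalar mulmxBr -scalemxAr.
  rewrite [X in X%:M]mxE [X in _ + X]mxE [X in _ - X]mxE divfK // subrr.
  exact: raddf0.
pose A := \sum_l y l *m delta_mx 0 l + (s *: t *m delta_mx 0 i + w *m delta_mx 0 j).
have : semipositive A.
  apply: semipositive_ones => h l.
  rewrite 2!(mulmxDl _ _ (const_mx 1)) !delta_mul_ones mulmx_suml.
  under eq_bigr => q _ do rewrite delta_mul_ones.
  by rewrite sw addrC subrK mxE.
move=> /hS /semipositive_comb_gt0 /(_ lam_ge0 lam_neq0) [l].
suff -> : lam *m L A = const_mx (- 1) by rewrite mxE ltr0N1.
rewrite 2!(linearD L) (linear_sum L) !hL !mulmxDr !mulmxA jw -scalemxAr it.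
rewrite scaler0 !mul0mx !addr0 mulmx_sumr.
under eq_bigr => h _ do rewrite hL !mulmxA hy mul_scalar_mx.
by rewrite -mulmx_sum_row /c mulmxKV.
Qed.

(** The hypothesis makes every nonnegative nonzero row a left eigenvector of [N].
    For the unit rows [e_k] this says that [N] is diagonal, and for the sums
    [e_k + e_l], tested against [e_k - e_l], that its diagonal is constant. *)
Lemma scalar_of_dual_kernel (R : realType) (m : nat) (N : 'M[R]_m) :
  (forall (lam : 'rV_m) (s : 'cV_m), nonneg_mx lam -> lam != 0 ->
    lam *m s = 0 -> lam *m N *m s = 0) ->
  exists c, N = c%:M.
Proof.
move=> hN.
have offdiag k l : k != l -> N k l = 0.
  move=> kl; have := hN (delta_mx 0 k) (delta_mx l 0)
    (delta_row_nonneg R k) (delta_row_neq0 R k).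
  rewrite mul_delta_mx_cond (negPf kl) mulr0n => /(_ erefl).
  by rewrite -rowE -colE => /matrixP /(_ 0 0); rewrite !mxE.
have diag k l : N k k = N l l.
  have [->//|kl] := eqVneq k l.
  have /matrixP /(_ 0 0) : (delta_mx 0 k + delta_mx 0 l : 'rV_m) *m N
      *m (delta_mx k 0 - delta_mx l 0 : 'cV_m) = 0.
    apply: hN => [p q||]; first by rewrite !mxE addr_ge0.
      apply/matrix0Pn; exists 0, k; rewrite !mxE !eqxx (negPf kl) addr0.
      exact: oner_neq0.
    rewrite mulmxDl !mulmxBr !mul_delta_mx_cond !eqxx (eq_sym l k) (negPf kl).
    by rewrite !mulr0n !mulr1n subr0 sub0r subrr.
  rewrite !mulmxDl -!rowE !mulmxBr -!colE !mxE.
  rewrite (offdiag k l) // (offdiag l k) 1?eq_sym // subr0 add0r.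
  by move/eqP; rewrite subr_eq0 => /eqP.
case: (pickP (fun _ : 'I_m => true)) => [k _|none].
  exists (N k k); apply/matrixP => p q; rewrite mxE.
  by have [->|pq] := eqVneq p q; rewrite ?mulr1n ?mulr0n // offdiag.
by exists 0; apply/matrixP => p; have := none p.
Qed.

(** * Signs of the factors *)

(** A negative entry [X k j] allows one to move from the column 1 in the direction
    of the [j]-th unit column, staying positive, to some [x] where entry [k] of
    [X *m x] vanishes; then [x *m e_i] is semipositive but its image has a zero
    row.  If row [j] of [invmx Y], say [r], has a negative entry, then [- 1 *m r] is semipositive,
    and its image [- (X *m 1) *m e_j] is nonpositive. *)
Lemma factor_signs (R : realType) (m n : nat) (i : 'I_n)
    (X : 'M[R]_m) (Y : 'M[R]_n) :
  (forall A : 'M_(m, n), semipositive A -> semipositive (X *m A *m Y)) ->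
  Y \in unitmx -> (0 < m)%N -> positive_mx (X *m (const_mx 1 : 'cV_m)) ->
  row_positive X /\ inverse_nonneg Y.
Proof.
move=> hS hY m_gt0 X1; split; [split=> [k j|k]|split=> // j l].
- rewrite leNgt; apply/negP => Xkj.
  pose x : 'cV_m := const_mx 1
    + (- (X *m (const_mx 1 : 'cV_m)) k 0 / X k j) *: delta_mx j 0.
  have : semipositive (x *m (delta_mx 0 i : 'rV_n)).
    apply: semipositive_ones; rewrite delta_mul_ones => p q; rewrite 3!mxE.
    rewrite ltr_wpDr // mulr_ge0 //; last by rewrite mxE.
    by rewrite mulNr oppr_ge0 ltW // pmulr_rlt0 // invr_lt0.
  move=> /hS /(semipositive_row_gt0 k) [l].
  rewrite mulmxA -mulmxA mxE big_ord1 mulmxDr -scalemxAr -colE.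
  rewrite [X in X * _]mxE [X in (_ + X) * _]mxE [X in (_ + _ * X) * _]mxE.
  by rewrite divfK ?lt_eqF // subrr mul0r ltxx.
- apply/existsP; apply: contraLR (X1 k 0) => /existsPn X0.
  rewrite -leNgt mxE big1 // => j _.
  by have := X0 j; rewrite negbK => /eqP ->; rewrite mul0r.
- rewrite leNgt; apply/negP => rl.
  pose r := row j (invmx Y).
  pose A : 'M_(m, n) := (- const_mx 1 : 'cV_m) *m r.
  (* Raising entry l of the column 1 by - b / r_l lowers r *m 1 by b, which
     makes it at most -1. *)
  pose b := `|(r *m (const_mx 1 : 'cV_n)) 0 0| + 1.
  have : semipositive A.
    exists (const_mx 1 + (- b / r 0 l) *: delta_mx l 0); split.
      move=> p q; rewrite 3!mxE ltr_wpDr // mulr_ge0 //; last by rewrite mxE.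
      rewrite mulNr oppr_ge0 ltW // pmulr_rlt0 ?invr_lt0 ?mxE //.
      by rewrite ltr_wpDl.
    move=> p q; rewrite -mulmxA mulmxDr -scalemxAr -colE.
    rewrite mxE big_ord1 2!mxE (ord1 q) mulN1r oppr_gt0.
    rewrite [X in X < 0]mxE [X in _ + X < 0]mxE [X in _ + _ * X < 0]mxE.
    rewrite divfK; last by rewrite mxE lt_eqF.
    by rewrite /b subr_lt0 ltr_pwDr ?ler_norm.
  move=> /hS /(semipositive_row_gt0 (Ordinal m_gt0)) [q].
  rewrite /A mulmxA -mulmxA /r -row_mul mulVmx // mulmxN mulNmx !mxE big_ord1.
  rewrite oppr_gt0 ltNge mulr_ge0 // ?(ltW (X1 _ _)) //.
  by rewrite !mxE ler0n.
Qed.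

(** * The equivalence *)

Theorem theorem3p12 (R : realType) (m n : nat) (hn : (2 <= n)%N)
    (hmn : (n <= m)%N) (L : {linear 'M[R]_(m, n) -> 'M[R]_(m, n)})
    (hL : bijective L)
    (hS : forall A : 'M[R]_(m, n), semipositive A -> semipositive (L A)) :
  (exists (X : 'M[R]_m) (Y : 'M[R]_n),
      [/\ X \in unitmx, row_positive X, inverse_nonneg Y
        & forall A : 'M[R]_(m, n), L A = X *m A *m Y])
  <->
  (forall (i : 'I_n) (x : 'cV[R]_m) (y : R),
      let Ai : 'M[R]_(m, n) := x *m (y *: delta_mx i 0 : 'cV[R]_n)^T in
      semipositive Ai -> \rank (L Ai) = 1%N).
Proof.
have m_gt0 : (0 < m)%N by apply: leq_trans (ltnW hn) hmn.
split=> [[X [Y [hX _ [hY _] hL']]] i x y Ai sAi|hrank].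
  have rY : row_free Y by rewrite row_free_unit.
  rewrite hL' mxrankMfree // -mxrank_tr trmx_mul mxrankMfree; last first.
    by rewrite row_free_unit unitmx_tr.
  rewrite mxrank_tr; apply/eqP; rewrite eqn_leq lt0n mxrank_eq0.
  rewrite (leq_trans (mxrankM_maxl _ _)) ?rank_leq_col //.
  have [l] := semipositive_row_gt0 (Ordinal m_gt0) sAi.
  by apply: contraTneq => ->; rewrite mxE ltxx.
have injL := bij_inj hL.
pose i0 : 'I_n := Ordinal (ltnW hn).
have /choice [X /choice [v hXv]] : forall l : 'I_n,
    exists (Xl : 'M_m) (v : 'rV_n), forall x : 'cV_m,
      L (x *m delta_mx 0 l) = Xl *m x *m v.
  move=> l.
  pose T : {linear 'cV_m -> 'M_(m, n)} := L \o mulmxr (delta_mx 0 l).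
  have minor : forall x a b c d, T x a b * T x c d = T x a d * T x c b.
    apply: minor_eq0_of_positive => x x_gt0 /=.
    have := hrank l x 1; rewrite scale1r trmx_delta => -> //.
    by apply: semipositive_ones; rewrite delta_mul_ones.
  have T1 : T (const_mx 1) != 0.
    rewrite /= -(linear0 L); apply/eqP => /injL /(congr1 (col l)).
    rewrite col_mul_delta => /matrixP /(_ (Ordinal m_gt0) 0); rewrite !mxE.
    by apply/eqP; rewrite oner_neq0.
  have [|] := rank_le1_space minor T1.
  - move=> [b [w hw]].
    have [Xl hXl] := linear_cV_mx (col b \o L \o mulmxr (delta_mx 0 l)).
    by exists Xl, w => x; rewrite -hXl; apply: hw.
  - by move=> /(no_common_column hn hmn injL hS).
pose Y := \matrix_l v l.
have hL1 l x : L (x *m delta_mx 0 l) = X l *m x *m row l Y by rewrite rowK hXv.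
have LE A : L A = \sum_l X l *m col l A *m row l Y.
  by rewrite {1}(mx_sum_col A) linear_sum; apply: eq_bigr => l _; rewrite hL1.
have X_unit l : X l \in unitmx.
  rewrite -row_full_unit; apply: row_full_of_kernel0 => x Xx.
  have : L (x *m delta_mx 0 l) = L 0 by rewrite hL1 Xx mul0mx linear0.
  by move=> /injL /(congr1 (col l)); rewrite col_mul_delta col0.
have Y_unit : Y \in unitmx.
  apply: right_factor_unit m_gt0 hL _ => A.
  exists (\matrix_(k, l) (X l *m col l A) k 0).
  rewrite LE; apply/matrixP=> k j; rewrite summxE [RHS]mxE.
  by apply: eq_bigr => l _; rewrite mxE big_ord1 !mxE.
have /choice [c hc] : forall l, exists c : R, X l = c *: X i0.
  move=> l.
  have [lam s lam_ge0 lam_neq0 ls|c hc] :=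
      @scalar_of_dual_kernel R m (X l *m invmx (X i0)).
    rewrite mulmxA -mulmxA.
    apply: (dual_kernel_sub hS hL1 X_unit Y_unit (i := i0)) => //.
    by rewrite -mulmxA mulKVmx.
  by exists c; rewrite -mul_scalar_mx -hc mulmxKV.
pose Z := \matrix_l (c l *: row l Y).
have LXZ A : L A = X i0 *m A *m Z.
  rewrite LE {2}(mx_sum_col A) mulmx_sumr mulmx_suml; apply: eq_bigr => l _.
  by rewrite hc mulmxA -[RHS]mulmxA -rowE [row l Z]rowK -!scalemxAl scalemxAr.
(* The rank one matrix L (1 *m e_i0) = (X i0 *m 1) *m row i0 Z is semipositive, so
   all entries of X i0 *m 1 have one and the same strict sign; this step is used
   with (X i0, Z) or (- X i0, - Z) according to that sign. *)
have conclude X' Z' : X' \in unitmx -> (forall A, L A = X' *m A *m Z') ->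
    positive_mx (X' *m (const_mx 1 : 'cV_m)) ->
    exists (X : 'M[R]_m) (Y : 'M[R]_n), [/\ X \in unitmx, row_positive X,
      inverse_nonneg Y & forall A : 'M[R]_(m, n), L A = X *m A *m Y].
  move=> X'_unit LE' X'1; exists X', Z'.
  have Z'_unit : Z' \in unitmx.
    by apply: right_factor_unit m_gt0 hL _ => A; exists (X' *m A); rewrite LE'.
  have hS' A : semipositive A -> semipositive (X' *m A *m Z').
    by rewrite -LE'; apply: hS.
  by have [] := factor_signs i0 hS' Z'_unit m_gt0 X'1.
have : semipositive ((const_mx 1 : 'cV[R]_m) *m (delta_mx 0 i0 : 'rV_n)).
  by apply: semipositive_ones; rewrite delta_mul_ones => k l; rewrite mxE.
move=> /hS [z [_]]; rewrite LXZ mulmxA -!mulmxA mulmxA.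
rewrite [delta_mx 0 i0 *m _]mx11_scalar mul_mx_scalar.
set al := (_ *m _) 0 0 => Xpos.
have [al_gt0|al_le0] := ltP 0 al.
  apply: (conclude (X i0) Z) => // k l.
  by have := Xpos k l; rewrite mxE pmulr_rgt0.
apply: (conclude (- X i0) (- Z)).
- by rewrite -scaleN1r unitmxZ // unitrN1.
- by move=> A; rewrite LXZ mulNmx mulNmx mulmxN opprK.
- move=> k l; have := Xpos k l; rewrite mxE mulNmx [X in _ -> 0 < X]mxE oppr_gt0.
  by apply: contraTlt => ge0; rewrite -leNgt mulr_le0_ge0.
Qed.
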